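(* Let $G=(V,E)$ be a finite connected simple graph with vertex set $V=\{a_1,\dots,a_N\}$, $N\ge 2$, let $\Psi=(\Psi_i)_{i=1}^N\in\mathbb{R}^N$ be a given potential on $V$, and let $\beta>0$. Let $\rho^o=(\rho^o_i)_{i=1}^N\in\mathcal{M}$ and let $\rho(t)=(\rho_i(t))_{i=1}^N:[0,\infty)\to\mathcal{M}$ be the solution, with initial value $\rho(0)=\rho^o$, of the system of ordinary differential equations (Fokker–Planck equation I) $$\frac{d\rho_i}{dt}=\sum_{j\in N(i),\,\Psi_j>\Psi_i}\big((\Psi_j+\beta\log\rho_j)-(\Psi_i+\beta\log\rho_i)\big)\rho_j+\sum_{j\in N(i),\,\Psi_j<\Psi_i}\big((\Psi_j+\beta\log\rho_j)-(\Psi_i+\beta\log\rho_i)\big)\rho_i+\sum_{j\in N(i),\,\Psi_j=\Psi_i}\beta(\rho_j-\rho_i),\qquad i=1,\dots,N.$$ Then there exists a constant $C=C(\rho^o;G,\Psi,\beta)>0$ such that for all $t\ge 0$ $$\Big\|\frac{\rho(t)}{\rho^*}-1\Big\|_{2,\rho^*}^2\le \Big\|\frac{\rho^o}{\rho^*}-1\Big\|_{2,\rho^*}^2\,e^{-Ct},$$ where $\rho^*$ is the Gibbs distribution. In particular, $\rho(t)$ converges exponentially to $\rho^*$ in the Euclidean metric of $\mathbb{R}^N$ as $t\to\infty$.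
   Context: $\mathcal{M}=\{\rho=(\rho_i)_{i=1}^N\in\mathbb{R}^N:\ \sum_{i=1}^N\rho_i=1,\ \rho_i>0 \text{ for all } i\}$ is the set of positive probability distributions on $V$. $N(i)=\{j:\{a_i,a_j\}\in E\}$ is the set of indices of neighbors of $a_i$. The Gibbs distribution $\rho^*=(\rho^*_i)_{i=1}^N\in\mathcal{M}$ is $\rho_i^*=\frac1K e^{-\Psi_i/\beta}$ with $K=\sum_{i=1}^N e^{-\Psi_i/\beta}$. For $\nu,\mu\in\mathcal{M}$, $\big\|\frac{\nu}{\mu}-1\big\|_{2,\mu}^2=\sum_{i=1}^N\big(\frac{\nu_i}{\mu_i}-1\big)^2\mu_i$. *)

(* Defs.v *)
From HB Require Import structures.
From mathcomp Require Import all_boot all_order all_algebra.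
From mathcomp Require Import all_classical all_reals all_analysis.

Set Implicit Arguments.
Unset Strict Implicit.
Unset Printing Implicit Defensive.
Import Order.TTheory GRing.Theory Num.Theory.
Import numFieldNormedType.Exports.

Local Open Scope classical_set_scope.
Local Open Scope ring_scope.

(* A simple graph on the vertices a_i, i : 'I_N, is given by its adjacency
   relation; [connect] is the reflexive transitive closure of fingraph. *)
Definition simple_graph (N : nat) (e : rel 'I_N) : Prop :=
  symmetric e /\ irreflexive e.

Definition connected_graph (N : nat) (e : rel 'I_N) : Prop :=
  forall i j : 'I_N, connect e i j.

Definition neighbors (N : nat) (e : rel 'I_N) (i : 'I_N) : {set 'I_N} :=
  [set j | e i j]%SET.

Section FokkerPlanck.
Variables (R : realType) (N : nat).
Implicit Types (Psi rho mu nu : 'rV[R]_N) (beta : R).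

Definition pos_distr : set 'rV[R]_N :=
  [set rho | \sum_i rho 0 i = 1 /\ forall i : 'I_N, 0 < rho 0 i].

Definition gibbs Psi beta : 'rV[R]_N :=
  let K := \sum_i expR (- Psi 0 i / beta) in
  \row_i (K^-1 * expR (- Psi 0 i / beta)).

(* The squared norm || nu / mu - 1 ||_{2, mu}^2. *)
Definition sqr_dist_rel nu mu : R :=
  \sum_i (nu 0 i / mu 0 i - 1) ^+ 2 * mu 0 i.

(* The library's norm on 'rV[R]_N is the sup norm. *)
Definition euclidean_dist mu nu : R :=
  Num.sqrt (\sum_i (mu 0 i - nu 0 i) ^+ 2).

Definition fokker_planck_rhs (e : rel 'I_N) Psi beta rho (i : 'I_N) : R :=
  let F j := Psi 0 j + beta * ln (rho 0 j) in
  \sum_(j in neighbors e i | Psi 0 i < Psi 0 j) (F j - F i) * rho 0 j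
  + \sum_(j in neighbors e i | Psi 0 j < Psi 0 i) (F j - F i) * rho 0 i
  + \sum_(j in neighbors e i | Psi 0 j == Psi 0 i)
      beta * (rho 0 j - rho 0 i).

(* f has derivative l at t relative to the domain A; for A = [0, +oo[ this is
   the usual derivative at t > 0 and the right derivative at t = 0. *)
Definition has_derivative_within (A : set R) (f : R -> R) (t l : R) : Prop :=
  (f s - f t) / (s - t) @[s --> within A t^'] --> l.

(* Only the values of rho on [0, +oo[ matter. *)
Definition fokker_planck_solution (e : rel 'I_N) Psi beta
    (rho0 : 'rV[R]_N) (rho : R -> 'rV[R]_N) : Prop :=
  [/\ forall t : R, 0 <= t -> pos_distr (rho t),
      rho 0 = rho0 &
      forall t : R, 0 <= t -> forall i : 'I_N,
        has_derivative_within `[0, +oo[ (fun s => rho s 0 i) t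
          (fokker_planck_rhs e Psi beta (rho t) i)].

Definition exp_cvg_euclidean (rho : R -> 'rV[R]_N) mu : Prop :=
  exists A c : R, [/\ 0 < A, 0 < c &
    forall t : R, 0 <= t -> euclidean_dist (rho t) mu <= A * expR (- (c * t))].

End FokkerPlanck.

(* Main.v *)
(* Let p be the Gibbs distribution and h_i = rho_i / p_i.  The equation reads
   rho_i' = sum_(j in N(i)) J_ij with J antisymmetric, of the sign of h_j - h_i,
   so sum_i G(h_i) p_i is nonincreasing for every convex G.  With G(x) = 1/x this
   gives a positive lower bound on rho_i(t), uniform in t and depending only on
   rho^o.  Under this bound (h_j - h_i) J_ij >= k (h_j - h_i)^2, and with
   G(x) = (x - 1)^2 the Poincare inequality of the connected graph turns the
   dissipation into exponential decay. *)
Require Import Defs.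
From HB Require Import structures.
From mathcomp Require Import all_boot all_order all_algebra.
From mathcomp Require Import all_classical all_reals all_analysis.
From mathcomp Require Import ring.

Set Implicit Arguments.
Unset Strict Implicit.
Unset Printing Implicit Defensive.
Import Order.TTheory GRing.Theory Num.Theory.
Import numFieldNormedType.Exports.

Local Open Scope classical_set_scope.
Local Open Scope ring_scope.

(** * Derivatives on the half-line and monotonicity *)

Lemma is_derive_of_has_derivative_within (R : realType) (f : R -> R) (t l : R) :
  0 < t -> has_derivative_within `[0, +oo[ f t l -> is_derive t 1 f l.
Proof.
move=> t0 df.
have dq : h^-1 *: ((f \o shift t) (h *: 1) - f t) @[h --> 0^'] --> l.
  apply/cvgrPdist_lt => eps eps0.
  move/cvgrPdist_lt/(_ _ eps0): df => [d /= d0 Hd].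
  near=> h.
  have h0 : h != 0 by near: h; exact: nbhs_dnbhs_neq.
  have := Hd (h + t); rewrite /= addrK [h *: 1]mulr1 mulrC; apply => /=.
  - rewrite opprD addrCA subrr addr0 normrN.
    by near: h; apply: dnbhs0_lt.
  - by rewrite -subr_eq0 addrK.
  (* An increment with [|h| <= t] keeps [h + t] in the half-line, so the restricted limit is in fact
     two-sided. *)
  - rewrite in_itv /= andbT -lerBlDr sub0r.
    have : `|h| <= t by near: h; apply: dnbhs0_le.
    by rewrite ler_norml => /andP[].
apply: DeriveDef; first by apply/cvg_ex; exists l.
exact/cvg_lim.
Unshelve. all: by end_near. Qed.

(** Multiplying the difference quotient by [s], which tends to 0, recovers right continuity. *)
Lemma cvg_at_right_of_has_derivative_within (R : realType) (f : R -> R) (l : R) :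
  has_derivative_within `[0, +oo[ f 0 l -> f s @[s --> 0^'+] --> f 0.
Proof.
move=> df.
have dq : (f s - f 0) / (s - 0) @[s --> 0^'+] --> l.
  apply: (cvg_trans _ df) => P [d /= d0 Hd]; exists d => //= s ds s0.
  by apply: Hd; rewrite //= ?in_itv/= ?andbT ?gt_eqF// ltW.
have ids : s @[s --> (0:R)^'+] --> (0:R) by exact: cvg_at_right_filter.
have cf : (f s - f 0) / (s - 0) * s + f 0 @[s --> 0^'+] --> l * 0 + f 0.
  by apply: cvgD; [exact: cvgM dq ids | exact: cvg_cst].
rewrite mulr0 add0r in cf; apply: cvg_trans cf; apply: near_eq_cvg; near=> s.
have s0 : 0 < s by near: s; exact: nbhs_right_gt.
by rewrite /= subr0 mulfVK ?gt_eqF// subrK.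
Unshelve. all: by end_near. Qed.

(** Derivatives are asked for only at [t > 0]; right continuity brings in the endpoint 0. *)
Lemma nincr_of_is_derive (R : realType) (f df : R -> R) :
  f s @[s --> 0^'+] --> f 0 ->
  (forall t : R, 0 < t -> is_derive t 1 f (df t)) ->
  (forall t : R, 0 < t -> df t <= 0) ->
  forall t : R, 0 <= t -> f t <= f 0.
Proof.
move=> cf0 Df dfle0 t t0.
have := @ler0_derive1_nincry R f 0; apply => // [x|x|].
- by rewrite in_itv /= andbT => /Df[].
- rewrite in_itv /= andbT => x0.
  by rewrite derive1E (@derive_val _ _ _ _ _ _ _ (Df _ x0)) dfle0.
apply/continuous_within_itvcyP; split => // x; rewrite in_itv /= andbT.
by move=> /Df[dx _]; exact/differentiable_continuous/derivable1_diffP.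
Qed.

(** * Poincare inequality on a connected graph *)

Section Graph.
Variables (R : realType) (N : nat) (e : rel 'I_N).

(** The sum runs over ordered pairs, so a symmetric [e] counts each undirected edge twice. *)
Definition dirichlet (h : 'I_N -> R) : R :=
  \sum_i \sum_(j | e i j) (h j - h i) ^+ 2.

Lemma edge_le_dirichlet (h : 'I_N -> R) (i j : 'I_N) :
  e i j -> `|h j - h i| <= Num.sqrt (dirichlet h).
Proof.
move=> eij; rewrite -sqrtr_sqr ler_wsqrtr // /dirichlet (bigD1 i) //= (bigD1 j) //=.
rewrite -addrA lerDl addr_ge0 // ?sumr_ge0 // => k _; rewrite ?sqr_ge0 //.
by rewrite sumr_ge0 // => l _; rewrite sqr_ge0.
Qed.

Lemma path_le_dirichlet (h : 'I_N -> R) (i : 'I_N) (s : seq 'I_N) :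
  path e i s -> `|h (last i s) - h i| <= (size s)%:R * Num.sqrt (dirichlet h).
Proof.
elim: s i => [|j s IHs] i /=; first by rewrite subrr normr0 mul0r.
move=> /andP[eij /IHs hs]; rewrite -(subrKA (h j)).
apply: (le_trans (ler_normD _ _)).
by rewrite -natr1 mulrDl mul1r lerD // edge_le_dirichlet.
Qed.

(** A path without repeated vertices has fewer than [N] edges, and each edge contributes at most the
    square root of [dirichlet h]. *)
Lemma osc_le_dirichlet (h : 'I_N -> R) (i j : 'I_N) :
  connected_graph e -> `|h j - h i| <= N%:R * Num.sqrt (dirichlet h).
Proof.
move=> /(_ i j)/connectP[s0 /shortenP[s es us _] ->].
apply: (le_trans (path_le_dirichlet h es)).
rewrite ler_wpM2r ?sqrtr_ge0 // ler_nat -[leqRHS]card_ord.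
by have := max_card (mem (i :: s)); rewrite (card_uniqP us); exact: ltnW.
Qed.

(** Since [p] has mass 1, [h i - m] is the [p]-average of the differences [h i - h j], each
    controlled by [osc_le_dirichlet]. *)
Lemma poincare (p h : 'I_N -> R) (m : R) :
  connected_graph e -> (forall i, 0 <= p i) -> \sum_i p i = 1 ->
  \sum_i h i * p i = m ->
  \sum_i (h i - m) ^+ 2 * p i <= N%:R ^+ 2 * dirichlet h.
Proof.
move=> conn p0 p1 <-.
have D0 : 0 <= dirichlet h.
  by apply: sumr_ge0 => i _; apply: sumr_ge0 => j _; exact: sqr_ge0.
rewrite -[leRHS]mulr1 -[X in _ <= _ * X]p1 mulr_sumr ler_sum // => i _.
rewrite ler_wpM2r // -{1}[dirichlet h](sqr_sqrtr D0) -exprMn.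
rewrite -real_normK ?num_real //.
rewrite lerXn2r ?nnegrE ?mulr_ge0 ?sqrtr_ge0 //.
rewrite -{1}[h i]mulr1 -[X in _ * X - _]p1 mulr_sumr -sumrB.
apply: (le_trans (ler_norm_sum _ _ _)).
rewrite -[leRHS]mulr1 -[X in _ <= _ * X]p1 mulr_sumr ler_sum // => j _.
by rewrite -mulrBl normrM (ger0_norm (p0 j)) ler_wpM2r // osc_le_dirichlet.
Qed.

End Graph.

Lemma exists_pos_lower_bound (R : realType) (n : nat) (a : 'I_n -> R) :
  (forall i, 0 < a i) -> exists c, [/\ 0 < c, c <= 1 & forall i, c <= a i].
Proof.
(* The default value 1 of the minimum gives [c <= 1] and covers [n = 0]. *)
move=> a0; exists (\big[Num.min/1]_i a i); split.
- by apply/lt_bigmin.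
- exact: bigmin_le_id.
- by move=> i; exact: bigmin_le_cond.
Qed.

(** * Gibbs densities and edge fluxes *)

Section Flux.
Variables (R : realType) (N : nat) (e : rel 'I_N).
Variables (Psi : 'rV[R]_N) (beta : R).
Hypotheses (he : simple_graph e) (beta0 : 0 < beta).
Implicit Types (rho : 'rV[R]_N) (i j : 'I_N).

Definition density rho i : R := rho 0 i / gibbs Psi beta 0 i.

(** Upwind flux from [j] into [i]: the free energy difference is weighted by the mass at the
    endpoint of higher potential. The last branch is the case of equal potentials. *)
Definition flux rho i j : R :=
  let F k := Psi 0 k + beta * ln (rho 0 k) in
  if Psi 0 i < Psi 0 j then (F j - F i) * rho 0 j
  else if Psi 0 j < Psi 0 i then (F j - F i) * rho 0 i
  else beta * (rho 0 j - rho 0 i).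

Lemma gibbs_norm_gt0 i : 0 < \sum_k expR (- Psi 0 k / beta).
Proof.
by rewrite (bigD1 i) //= ltr_pwDl ?expR_gt0 // sumr_ge0 // => k _; rewrite expR_ge0.
Qed.

Lemma gibbs_gt0 i : 0 < gibbs Psi beta 0 i.
Proof. by rewrite mxE mulr_gt0 ?expR_gt0 // invr_gt0 (gibbs_norm_gt0 i). Qed.

Lemma sum_gibbs (i : 'I_N) : \sum_k gibbs Psi beta 0 k = 1.
Proof.
under eq_bigr do rewrite mxE.
by rewrite -mulr_sumr mulVf // gt_eqF // (gibbs_norm_gt0 i).
Qed.

Lemma density_gt0 rho i : 0 < rho 0 i -> 0 < density rho i.
Proof. by move=> r0; rewrite divr_gt0 // gibbs_gt0. Qed.

Lemma densityK rho i : density rho i * gibbs Psi beta 0 i = rho 0 i.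
Proof. by rewrite mulfVK // gt_eqF // gibbs_gt0. Qed.

Lemma pos_distr_le1 rho i : pos_distr rho -> rho 0 i <= 1.
Proof.
by move=> [<- r0]; rewrite (bigD1 i) //= lerDl sumr_ge0 // => k _; rewrite ltW.
Qed.

(** [beta * ln (density rho k)] is the free energy at [k] plus [beta] times the logarithm of the
    partition sum, a constant that cancels in the difference. *)
Lemma free_energy_diff rho i j : 0 < rho 0 i -> 0 < rho 0 j ->
  Psi 0 j + beta * ln (rho 0 j) - (Psi 0 i + beta * ln (rho 0 i))
  = beta * (ln (density rho j) - ln (density rho i)).
Proof.
have K0 := gibbs_norm_gt0 i.
have lnE k : 0 < rho 0 k -> beta * ln (density rho k) =
    Psi 0 k + beta * ln (rho 0 k) + beta * ln (\sum_k expR (- Psi 0 k / beta)).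
  move=> rk; rewrite /density ln_div ?posrE ?gibbs_gt0 // mxE.
  rewrite lnM ?posrE ?invr_gt0 ?expR_gt0 // lnV ?posrE // expRK.
  by field; rewrite gt_eqF.
by move=> ri rj; rewrite mulrBr !lnE //; ring.
Qed.

Lemma fluxC rho i j : flux rho j i = - flux rho i j.
Proof. by rewrite /flux; case: ltgtP => _; ring. Qed.

Lemma fokker_planck_rhsE rho i :
  fokker_planck_rhs e Psi beta rho i = \sum_(j | e i j) flux rho i j.
Proof.
rewrite /fokker_planck_rhs [RHS](bigID (fun j => Psi 0 i < Psi 0 j)) /= -addrA.
congr (_ + _).
  by apply: eq_big => j; rewrite inE // /flux => /andP[_ ->].
rewrite [RHS](bigID (fun j => Psi 0 j < Psi 0 i)) /=; congr (_ + _).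
  apply: eq_big => j; rewrite inE; first by case: ltgtP; rewrite ?andbF ?andbT.
  by rewrite /flux => /andP[_ /[dup] ji ->]; rewrite ltNge (ltW ji).
apply: eq_big => j; rewrite inE; first by case: ltgtP; rewrite ?andbF ?andbT.
by rewrite /flux => /andP[_ /eqP ->]; rewrite ltxx.
Qed.

(** Discrete integration by parts: the sum over edges is added to its copy with [i] and [j]
    exchanged, and [fluxC] combines the two. *)
Lemma sum_mul_fokker_planck_rhs rho (g : 'I_N -> R) :
  2 * \sum_i g i * fokker_planck_rhs e Psi beta rho i =
  - \sum_i \sum_(j | e i j) (g j - g i) * flux rho i j.
Proof.
have [esym _] := he.
pose A := \sum_i \sum_(j | e i j) g i * flux rho i j.
have -> : \sum_i g i * fokker_planck_rhs e Psi beta rho i = A.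
  by apply: eq_bigr => i _; rewrite fokker_planck_rhsE mulr_sumr.
have A2 : A = \sum_i \sum_(j | e i j) g j * flux rho j i.
  rewrite /A (exchange_big_dep predT) //=; apply: eq_bigr => i _.
  by apply: eq_bigl => j; rewrite esym.
rewrite mulr_natl mulr2n {2}A2 -big_split -sumrN; apply: eq_bigr => i _ /=.
rewrite -big_split -sumrN; apply: eq_bigr => j _ /=.
by rewrite (fluxC rho i j); ring.
Qed.

(* [ln x - ln y >= (x - y) / x]; the factor [rho_j] cancels the denominator,
   while for [rho_i] one uses that densities are at most [1 / gibbs]. *)
Lemma flux_ge rho (c : R) i j :
  pos_distr rho -> 0 <= c <= 1 -> c <= rho 0 i ->
  density rho i <= density rho j ->
  beta * c * gibbs Psi beta 0 j * (density rho j - density rho i) <= flux rho i j.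
Proof.
move=> prho /andP[c0 c1] ci hij; have [_ rho0] := prho.
have pj0 := gibbs_gt0 j; have hi0 := density_gt0 (rho0 i).
have hj0 := density_gt0 (rho0 j).
have lnge : (density rho j - density rho i) / density rho j <=
    ln (density rho j) - ln (density rho i).
  rewrite mulrBl divff ?gt_eqF // -[leRHS]opprB -[leLHS]opprB lerN2.
  rewrite -ln_div ?posrE // -{1}(subrKC 1 (_ / _)); apply: le_ln1Dx.
  by rewrite -[ltLHS]add0r ltrD2r divr_gt0.
have pinv : gibbs Psi beta 0 j <= (density rho j)^-1.
  rewrite -[leLHS]invrK lef_pV2 ?posrE ?invr_gt0 // ler_pdivrMr //.
  by rewrite mulVf ?gt_eqF // pos_distr_le1.
have d0 : 0 <= density rho j - density rho i by rewrite subr_ge0.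
rewrite /flux !free_energy_diff //; case: ltgtP => Pij.
- apply: (@le_trans _ _
    (beta * ((density rho j - density rho i) / density rho j) * rho 0 j)).
    rewrite -(densityK rho j).
    have -> : beta * ((density rho j - density rho i) / density rho j) *
      (density rho j * gibbs Psi beta 0 j) =
      beta * gibbs Psi beta 0 j * (density rho j - density rho i).
      by field; rewrite gt_eqF.
    by rewrite ler_wpM2r // ler_pM2r // ger_pMr.
  by rewrite ler_pM2r // ler_pM2l.
- apply: (@le_trans _ _
    (beta * ((density rho j - density rho i) / density rho j) * rho 0 i)).
    have -> : beta * c * gibbs Psi beta 0 j * (density rho j - density rho i) =
      beta * (density rho j - density rho i) * (c * gibbs Psi beta 0 j) by ring.
    have -> : beta * ((density rho j - density rho i) / density rho j) * rho 0 i =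
      beta * (density rho j - density rho i) * (rho 0 i * (density rho j)^-1)
      by ring.
    rewrite ler_wpM2l ?mulr_ge0 // ?(ltW beta0) //.
    by rewrite ler_pM // ltW.
  by rewrite ler_pM2r // ler_pM2l.
(* Equal potentials give equal Gibbs weights, so here the flux is [beta] times this weight times the
   density difference, without logarithms; [c <= 1] concludes. *)
- have pE : gibbs Psi beta 0 i = gibbs Psi beta 0 j by rewrite !mxE Pij.
  rewrite -(densityK rho i) -(densityK rho j) pE -mulrBl.
  rewrite [_ * gibbs _ _ _ _ in leRHS]mulrC mulrA.
  by rewrite ler_wpM2r // ler_pM2r // ger_pMr.
Qed.

Lemma flux_sgn rho (g : R -> R) i j :
  pos_distr rho -> (forall x y, 0 < x -> x <= y -> g x <= g y) ->
  0 <= (g (density rho j) - g (density rho i)) * flux rho i j.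
Proof.
move=> prho gmono; have [_ rho0] := prho.
wlog hij : i j / density rho i <= density rho j.
  move=> W; have [/W //|/ltW/W] := leP (density rho i) (density rho j).
  by rewrite (fluxC rho i j) mulrN -mulNr opprB.
rewrite mulr_ge0 ?subr_ge0 ?gmono ?density_gt0 //.
(* With [c = 0] the lower bound reduces to nonnegativity of the flux. *)
have := @flux_ge rho 0 i j prho _ (ltW (rho0 i)) hij.
by rewrite mulr0 !mul0r lexx ler01; exact.
Qed.

(** This is [flux_ge] multiplied by the density difference, whose sign may be fixed by antisymmetry
    of the flux. *)
Lemma flux_coercive rho (c q : R) i j :
  pos_distr rho -> 0 <= c <= 1 -> (forall k, c <= rho 0 k) ->
  (forall k, q <= gibbs Psi beta 0 k) ->
  beta * c * q * (density rho j - density rho i) ^+ 2 <=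
  (density rho j - density rho i) * flux rho i j.
Proof.
move=> prho c01 crho qp.
wlog hij : i j / density rho i <= density rho j.
  move=> W; have [/W //|/ltW/W] := leP (density rho i) (density rho j).
  by rewrite (fluxC rho i j) mulrN -mulNr opprB -[in leLHS]opprB sqrrN.
have d0 : 0 <= density rho j - density rho i by rewrite subr_ge0.
rewrite expr2 mulrCA ler_wpM2l //.
apply: le_trans (flux_ge prho c01 (crho i) hij).
by rewrite ler_wpM2r // ler_wpM2l // mulr_ge0 ?(ltW beta0) //; case/andP: c01.
Qed.

(** * Energies along a solution and exponential decay *)

Section Solution.
Variables (rho0 : 'rV[R]_N) (rho : R -> 'rV[R]_N).
Hypothesis sol : fokker_planck_solution e Psi beta rho0 rho.

Section Energy.
Variables (G g : R -> R).
Hypothesis dG : forall x : R, 0 < x -> is_derive x 1 G (g x).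

Let energy (t : R) : R :=
  \sum_i G (density (rho t) i) * gibbs Psi beta 0 i.

(** Chain rule; the Gibbs weight cancels the denominator of [density]. *)
Lemma is_derive_energy (t : R) : 0 < t ->
  is_derive t 1 energy
    (\sum_i g (density (rho t) i) * fokker_planck_rhs e Psi beta (rho t) i).
Proof.
move=> t0; have [prho _ drho] := sol.
have -> : energy = \sum_i (gibbs Psi beta 0 i \*:
    (G \o ((gibbs Psi beta 0 i)^-1 \*: (fun s => rho s 0 i)))).
  apply/funext => s; rewrite fct_sumE; apply: eq_bigr => i _.
  by rewrite /= mulrC /density [rho s 0 i / _]mulrC.
apply: is_derive_sum => i; have p0 := gibbs_gt0 i.
have di := is_derive_of_has_derivative_within t0 (drho _ (ltW t0) i).
have [_ /(_ i) ri0] := prho _ (ltW t0).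
have dGi := dG (density_gt0 ri0).
rewrite /density mulrC in dGi.
apply: is_derive_eq.
rewrite /= /density [rho t 0 i / _]mulrC /GRing.scale /= mulrCA.
by rewrite mulVKf // gt_eqF.
Qed.

Lemma cvg_energy : energy s @[s --> 0^'+] --> energy 0.
Proof.
have [prho _ drho] := sol.
apply: cvg_big => [|i _]; first exact: add_continuous.
apply: cvgM; last exact: cvg_cst.
have [_ /(_ i) ri0] := prho _ (lexx 0).
apply: continuous_cvg.
  have [dGi _] := dG (density_gt0 ri0).
  exact/differentiable_continuous/derivable1_diffP.
apply: cvgM; last exact: cvg_cst.
exact: cvg_at_right_of_has_derivative_within (drho _ (lexx 0) i).
Qed.

End Energy.

(* The energy with [G x = 1 / x] blows up at the boundary of the simplex and is
   nonincreasing, so that it keeps the solution away from the boundary. *)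
Lemma inv_energy_le (t : R) : 0 <= t ->
  \sum_i (density (rho t) i)^-1 * gibbs Psi beta 0 i <=
  \sum_i (density rho0 i)^-1 * gibbs Psi beta 0 i.
Proof.
move=> t0; have [prho <- _] := sol.
have dG (x : R) : 0 < x -> is_derive x 1 GRing.inv (- x ^- 2).
  move=> x0; have xN0 : x != 0 by rewrite gt_eqF.
  by apply: is_derive_eq (is_deriveV xN0 (is_derive_id x 1)) _;
    rewrite /GRing.scale /= mulr1.
apply: nincr_of_is_derive (cvg_energy dG) (is_derive_energy dG) _ _ t0 => s s0.
rewrite -(pmulr_rle0 _ (ltr0Sn R 1)).
rewrite (sum_mul_fokker_planck_rhs _ (fun i => - density (rho s) i ^- 2)).
rewrite oppr_le0 sumr_ge0 // => i _; rewrite sumr_ge0 // => j _.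
apply: (@flux_sgn _ (fun x => - x ^- 2)) => [|x y x0 xy]; first exact/prho/ltW.
have y0 := lt_le_trans x0 xy.
by rewrite lerN2 lef_pV2 ?posrE ?exprn_gt0 // lerXn2r ?nnegrE ?(ltW x0) ?(ltW y0).
Qed.

(** The term of index [i] in the inverse energy is the squared Gibbs weight over [rho t 0 i]; it is
    at most the whole sum, hence at most the initial energy. *)
Lemma solution_ge (i : 'I_N) (t : R) : 0 <= t ->
  gibbs Psi beta 0 i ^+ 2 / (\sum_k (density rho0 k)^-1 * gibbs Psi beta 0 k)
  <= rho t 0 i.
Proof.
move=> t0; have [prho r0 _] := sol; have [_ rt0] := prho _ t0.
have [_ r00] := prho _ (lexx 0); rewrite r0 in r00.
have pos (r : 'rV[R]_N) k : 0 < r 0 k -> 0 <= (density r k)^-1 * gibbs Psi beta 0 k.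
  by move=> rk; rewrite mulr_ge0 ?invr_ge0 // ltW ?gibbs_gt0 ?density_gt0.
have S0 : 0 < \sum_k (density rho0 k)^-1 * gibbs Psi beta 0 k.
  rewrite (bigD1 i) //= ltr_pwDl ?mulr_gt0 ?invr_gt0 ?density_gt0 ?gibbs_gt0 //.
  by rewrite sumr_ge0 // => k _; rewrite pos.
rewrite ler_pdivrMr // mulrC -ler_pdivrMr //.
apply: le_trans (inv_energy_le t0).
rewrite (bigD1 i) //= -[leLHS]addr0 lerD ?sumr_ge0 // => [|k _]; last exact: pos.
by rewrite /density invf_div expr2 mulrAC.
Qed.

Lemma sqr_dist_decay (c q : R) :
  connected_graph e -> 0 <= c <= 1 ->
  (forall t : R, 0 <= t -> forall i, c <= rho t 0 i) ->
  0 <= q -> (forall i, q <= gibbs Psi beta 0 i) -> (0 < N)%N ->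
  forall t : R, 0 <= t ->
  sqr_dist_rel (rho t) (gibbs Psi beta) <=
  sqr_dist_rel rho0 (gibbs Psi beta) * expR (- (beta * c * q / N%:R ^+ 2 * t)).
Proof.
move=> conn c01 crho q0 qp N0 t t0; have [prho <- _] := sol.
set C := _ / _.
pose L s := sqr_dist_rel (rho s) (gibbs Psi beta).
have dG (x : R) : 0 < x -> is_derive x 1 (fun y => (y - 1) ^+ 2) (2 * (x - 1)).
  move=> _; have -> : (fun y : R => (y - 1) ^+ 2) = (id - cst 1) ^+ 2 by [].
  by apply: is_derive_eq; rewrite subr0 /GRing.scale /= mulr1 expr1.
pose dL s := \sum_i 2 * (density (rho s) i - 1) *
  fokker_planck_rhs e Psi beta (rho s) i.
(* [L] unfolds to the energy of the function sending [x] to [(x - 1) ^+ 2]. *)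
have cL : L s @[s --> 0^'+] --> L 0 by exact: cvg_energy dG.
have DL (s : R) : 0 < s -> is_derive s 1 L (dL s) by exact: is_derive_energy dG s.
have dLle (s : R) : 0 < s -> dL s <= - (C * L s).
  move=> s0; have ps := prho _ (ltW s0).
  (* The 2 from differentiating the square is the factor in [sum_mul_fokker_planck_rhs]. *)
  have -> : dL s = 2 * \sum_i (density (rho s) i - 1) *
      fokker_planck_rhs e Psi beta (rho s) i.
    by rewrite mulr_sumr; apply: eq_bigr => i _; rewrite mulrA.
  rewrite sum_mul_fokker_planck_rhs lerN2.
  apply: (@le_trans _ _ (beta * c * q * dirichlet e (density (rho s)))).
    have := poincare conn (fun i => ltW (gibbs_gt0 i)) (sum_gibbs (Ordinal N0))
      (erefl (\sum_i density (rho s) i * gibbs Psi beta 0 i)).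
    (* The Gibbs mean of the density is the total mass of [rho s], so the variance in [poincare] is
       [L s]. *)
    have -> : \sum_i density (rho s) i * gibbs Psi beta 0 i = 1.
      by case: ps => <- _; apply: eq_bigr => i _; exact: densityK.
    move=> poinc; rewrite /C -mulrA ler_wpM2l //.
      by case/andP: c01 => c0 _; rewrite !mulr_ge0 // ltW.
    by rewrite ler_pdivrMl ?exprn_gt0 ?ltr0n.
  rewrite /dirichlet mulr_sumr ler_sum // => i _.
  rewrite mulr_sumr ler_sum // => j _.
  by rewrite opprB addrA subrK flux_coercive // => k; rewrite crho // ltW.
have De (s : R) : is_derive s 1 (expR \o (C \*: id)) (expR (C * s) * C).
  by apply: is_derive_eq; rewrite /GRing.scale /= mulr1.
(* Gronwall argument: [dLle] makes [expR (C * s) * L s] nonincreasing. *)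
have Cle : expR (C * t) * L t <= expR (C * 0) * L 0.
  apply: (@nincr_of_is_derive R ((expR \o (C \*: id)) * L)
    (fun s => expR (C * s) * dL s + L s * (expR (C * s) * C))) => // [|s s0|s s0].
  - apply: cvgM cL; have [/derivable1_diffP/differentiable_continuous ce _] := De 0.
    exact: cvg_at_right_filter.
  - exact: is_deriveM (De s) (DL s s0).
  - rewrite [L s * _]mulrCA -mulrDr pmulr_rle0 ?expR_gt0 //.
    by rewrite -lerBrDr sub0r [L s * C]mulrC dLle.
rewrite mulr0 expR0 mul1r in Cle.
by rewrite expRN ler_pdivlMr ?expR_gt0 // mulrC.
Qed.

End Solution.

End Flux.

Theorem theorem3p1 (R : realType) (N : nat) (hN : (2 <= N)%N)
  (e : rel 'I_N) (he : simple_graph e) (hconn : connected_graph e)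
  (Psi : 'rV[R]_N) (beta : R) (hbeta : 0 < beta)
  (rho0 : 'rV[R]_N) (hrho0 : pos_distr rho0) :
  exists2 C : R, 0 < C &
    forall rho : R -> 'rV[R]_N,
      fokker_planck_solution e Psi beta rho0 rho ->
      (forall t : R, 0 <= t ->
         sqr_dist_rel (rho t) (gibbs Psi beta)
           <= sqr_dist_rel rho0 (gibbs Psi beta) * expR (- (C * t)))
      /\ exp_cvg_euclidean rho (gibbs Psi beta).
Proof.
have N0 : (0 < N)%N by exact: ltnW.
have p0 (i : 'I_N) : 0 < gibbs Psi beta 0 i by exact: gibbs_gt0.
have [q [q0 q1 qp]] := exists_pos_lower_bound p0.
have [_ r0] := hrho0.
pose S := \sum_k (density Psi beta rho0 k)^-1 * gibbs Psi beta 0 k.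
have S0 : 0 < S.
  rewrite /S (bigD1 (Ordinal N0)) //= ltr_pwDl ?mulr_gt0 ?invr_gt0 ?density_gt0 //.
  by rewrite sumr_ge0 // => k _; rewrite mulr_ge0 ?invr_ge0 ?ltW ?density_gt0.
have [c [c0 c1 cp]] := @exists_pos_lower_bound R N
  (fun i => gibbs Psi beta 0 i ^+ 2 / S)
  (fun i => divr_gt0 (exprn_gt0 2 (p0 i)) S0).
(* [c] comes from the bound of [solution_ge], which involves only [rho0], so [C] is fixed before the
   solution is introduced. *)
pose C := beta * c * q / N%:R ^+ 2.
have C0 : 0 < C by rewrite divr_gt0 ?mulr_gt0 ?exprn_gt0 ?ltr0n.
exists C => // rho sol.
have decay (t : R) : 0 <= t -> sqr_dist_rel (rho t) (gibbs Psi beta)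
    <= sqr_dist_rel rho0 (gibbs Psi beta) * expR (- (C * t)).
  apply: (sqr_dist_decay he hbeta sol) => // [|s s0 i|]; last exact: ltW.
    by rewrite (ltW c0).
  exact: le_trans (cp i) (solution_ge he hbeta sol i s0).
split => //.
set L0 := sqr_dist_rel rho0 _ in decay.
have L00 : 0 <= L0.
  by apply: sumr_ge0 => i _; rewrite mulr_ge0 ?sqr_ge0 ?ltW.
(* Taking square roots halves the rate; the added 1 keeps the prefactor positive when [L0 = 0]. *)
exists (Num.sqrt L0 + 1), (C / 2); split.
- by rewrite ltr_wpDl ?sqrtr_ge0.
- by rewrite divr_gt0.
move=> t t0.
apply: (@le_trans _ _ (Num.sqrt L0 * expR (- (C / 2 * t)))); last first.
  by rewrite ler_wpM2r ?expR_ge0 // lerDl.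
rewrite -(ger0_norm (expR_ge0 (- (C / 2 * t)))) -sqrtr_sqr -sqrtrM // ler_wsqrtr //.
have -> : expR (- (C / 2 * t)) ^+ 2 = expR (- (C * t)).
  by rewrite expr2 -expRD; congr expR; field.
(* Termwise comparison: Gibbs weights are at most 1, so their squares are at most the weights
   themselves. *)
apply: le_trans (decay t t0); apply: ler_sum => i _.
have pdistr : pos_distr (gibbs Psi beta) by split; first exact: sum_gibbs i.
have -> : rho t 0 i - gibbs Psi beta 0 i =
    (rho t 0 i / gibbs Psi beta 0 i - 1) * gibbs Psi beta 0 i.
  by rewrite mulrBl mul1r mulfVK // gt_eqF.
by rewrite exprMn ler_wpM2l ?sqr_ge0 // expr2 ger_pMl // pos_distr_le1.
Qed.
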